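(* Let $T\colon c\to c$ be the Cesàro operator, and let $X=\{x\in c:(T^nx)_{n\ge0}\text{ converges in norm as }n\to\infty\}$. (a) Suppose that $(r_n)_{n\ge0}$ is a sequence of positive numbers such that $r_n=o(n^{-1/2})$ as $n\to\infty$. Then there exists $x=(x_k)_{k\ge0}\in X$ such that the series $\sum_{k=1}^\infty\frac{x_k-x_0}{k}$ is convergent but $\limsup_{n\to\infty} r_n^{-1}\|T^nx-Px\|_\infty=\infty$. (b) Suppose that $(r_n)_{n\ge0}$ is a sequence of positive numbers such that $r_n\to0$ as $n\to\infty$. Then there exists $x\in X$ such that $\|T^nx-Px\|_\infty\ge r_n$ for all $n\ge0$.
   Context: $c$ denotes the complex Banach space of convergent complex sequences $x=(x_k)_{k\ge0}$, endowed with the supremum norm $\|\cdot\|_\infty$. The Cesàro operator $T\colon c\to c$ is the bounded linear operator given by $(Tx)_k=\frac{1}{k+1}\sum_{j=0}^k x_j$ for $k\ge0$. The operator $P\colon c\to c$ is defined by $Px=x_0e_\infty$, where $e_\infty=(1,1,1,\dots)$. *)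

(* Defs.v *)
From Stdlib Require Import Reals Lra Lia.
From Coquelicot Require Import Coquelicot.
Open Scope R_scope.

(** The space [c] of convergent complex sequences, as a predicate on [nat -> C]. *)
Definition in_c (x : nat -> C) : Prop :=
  exists l : C, filterlim x eventually (locally l).

(** [Sup_seq] lives in [Rbar] and is finite on bounded sequences; see
    [supnorm_finite] for elements of [c].  The projection to [R] sends an
    infinite supremum to [0], so [supnorm] is only meaningful on bounded
    sequences. *)
Definition supnorm (x : nat -> C) : R :=
  real (Sup_seq (fun k => Finite (Cmod (x k)))).

Definition seq_minus (x y : nat -> C) : nat -> C := fun k => (x k - y k)%C.

(** [sum_n x k] is the sum of the [k + 1] terms [x 0, ..., x k]. *)
Definition cesaro (x : nat -> C) : nat -> C :=
  fun k => (sum_n x k / RtoC (INR k + 1))%C.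

Definition cesaro_iter (n : nat) (x : nat -> C) : nat -> C := Nat.iter n cesaro x.

Definition e_infty : nat -> C := fun _ => RtoC 1.

Definition proj0 (x : nat -> C) : nat -> C := fun k => (x 0%nat * e_infty k)%C.

Definition in_X (x : nat -> C) : Prop :=
  in_c x /\
  exists y : nat -> C, in_c y /\
    is_lim_seq (fun n => supnorm (seq_minus (cesaro_iter n x) y)) 0.

Lemma supnorm_finite (x : nat -> C) :
  in_c x -> Sup_seq (fun k => Finite (Cmod (x k))) = Finite (supnorm x).
Proof.
intros Hx.
destruct (@filterlim_bounded C_AbsRing C_NormedModule x Hx) as [M HM].
unfold supnorm.
assert (H1 : Rbar_le (Sup_seq (fun k => Finite (Cmod (x k)))) (Finite M)).
{ replace (Finite M) with (Sup_seq (fun _ => Finite M)).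
  - apply Sup_seq_le; intros n; exact (HM n).
  - apply is_sup_seq_unique; intros eps; split.
    + intros _; simpl; destruct eps; simpl; lra.
    + exists 0%nat; simpl; destruct eps; simpl; lra. }
assert (H0 : Rbar_le (Finite (Cmod (x 0%nat)))
               (Sup_seq (fun k => Finite (Cmod (x k))))).
{ apply (Sup_seq_minor_le (fun k => Finite (Cmod (x k))) _ 0%nat).
  apply Rbar_le_refl. }
revert H0 H1; destruct (Sup_seq _); simpl; intros; easy.
Qed.

Lemma in_c_minus (x y : nat -> C) : in_c x -> in_c y -> in_c (seq_minus x y).
Proof.
intros [l Hl] [m Hm]; exists (l - m)%C.
apply (filterlim_comp_2 (G := locally l) (H := locally (opp m : C_NormedModule))
  x (fun k => opp (y k)) (fun a b : C_NormedModule => plus a b) Hl).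
- exact (filterlim_comp _ _ _ y opp _ _ _ Hm
    (@filterlim_opp C_AbsRing C_NormedModule m)).
- apply (@filterlim_plus C_AbsRing C_NormedModule l (opp m)).
Qed.

Lemma in_c_cst (a : C) : in_c (fun _ => a).
Proof. exists a; apply filterlim_const. Qed.

Lemma in_c_proj0 (x : nat -> C) : in_c (proj0 x).
Proof. exact (in_c_cst (x 0%nat * RtoC 1)%C). Qed.

Lemma cesaro_re_im (x : nat -> C) (k : nat) :
  cesaro x k = (sum_f_R0 (fun j => fst (x j)) k / INR (S k),
                sum_f_R0 (fun j => snd (x j)) k / INR (S k)).
Proof.
assert (H : sum_n x k =
  (sum_f_R0 (fun j => fst (x j)) k, sum_f_R0 (fun j => snd (x j)) k)).
{ induction k as [|k IH].
  - rewrite sum_O; simpl; destruct (x 0%nat); reflexivity.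
  - rewrite sum_Sn, IH; reflexivity. }
assert (Hk : INR k + 1 <> 0) by (rewrite <- S_INR; apply not_0_INR; lia).
unfold cesaro; rewrite H, S_INR.
unfold Cdiv, Cmult, Cinv, RtoC; cbn [fst snd].
f_equal; field; exact Hk.
Qed.

Lemma in_c_cesaro (x : nat -> C) : in_c x -> in_c (cesaro x).
Proof.
intros [[a b] Hl].
assert (H : forall (u : nat -> R) (l : R), is_lim_seq u l ->
  filterlim (fun k => sum_f_R0 u k / INR (S k)) eventually (locally l)).
{ intros u l Hu.
  apply is_lim_seq_Reals, Cesaro_1 in Hu.
  apply is_lim_seq_Reals in Hu.
  apply is_lim_seq_incr_1 in Hu.
  exact Hu. }
exists (a, b).
apply filterlim_ext with (f := fun k =>
  (sum_f_R0 (fun j => fst (x j)) k / INR (S k),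
   sum_f_R0 (fun j => snd (x j)) k / INR (S k))).
{ intros k; symmetry; apply cesaro_re_im. }
assert (H1 : is_lim_seq (fun j => fst (x j)) a).
{ intros P [eps HP]; destruct (Hl (fun z => ball a eps (fst z))) as [N HN].
  - exists eps; intros y Hy; exact (proj1 Hy).
  - exists N; intros n Hn; apply HP, (HN n Hn). }
assert (H2 : is_lim_seq (fun j => snd (x j)) b).
{ intros P [eps HP]; destruct (Hl (fun z => ball b eps (snd z))) as [N HN].
  - exists eps; intros y Hy; exact (proj2 Hy).
  - exists N; intros n Hn; apply HP, (HN n Hn). }
apply H in H1; apply H in H2.
intros P [eps HP].
destruct (H1 (ball a eps)) as [N1 HN1]; [exists eps; auto|].
destruct (H2 (ball b eps)) as [N2 HN2]; [exists eps; auto|].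
exists (N1 + N2)%nat; intros n Hn; apply HP; split;
  [apply HN1 | apply HN2]; lia.
Qed.

Lemma in_c_cesaro_iter (n : nat) (x : nat -> C) : in_c x -> in_c (cesaro_iter n x).
Proof. intros Hx; induction n; [exact Hx | apply in_c_cesaro, IHn]. Qed.

(* Main.v *)
(** Let [T] be the Cesàro operator.  On sequences vanishing at index [0] it
preserves the sum of [x_k / k] over [k >= 1], and in the variable [log k] it is
an average over the past with an exponential weight of mean and variance one.

(a) Take [x = (0, 1, 0, 0, ...)].  The weighted sequence [(T^n x)_k / k] has
mass one, concentrated where the harmonic number of [k] is within [O(sqrt n)]
of [n]; such [k] have total weight [O(sqrt n)], so some entry of [T^n x] is at
least a constant times [1 / sqrt n].

(b) [T^n] maps the indicator of [{k >= 1}] to a sequence with limit one, so one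
of its entries, at index [K n] say, is at least [1/2].  Take [x_0 = 0] and
[x_k = 2 sup {r n : k <= K n}]; then [(T^n x)_(K n) >= r n].

Both sequences tend to [0 = x_0].  For such [x] one has [T^n x -> 0] uniformly:
by density [x] may be taken finitely supported, and an energy identity in the
norm [sum of x_k^2 / k] makes the energy of [T^n x - T^(n+1) x] at most [E / n];
its entry [k] is [k] times the step of [T^(n+1) x] from [k - 1] to [k], so
Cauchy-Schwarz bounds the supremum. *)
Require Import Defs.
From Stdlib Require Import Reals Lra Lia ClassicalEpsilon.
From Coquelicot Require Import Coquelicot.
Open Scope R_scope.

(** * The averaging operator on real sequences: positivity, linearity, constants and limits *)

Definition avg (x : nat -> R) (k : nat) : R := sum_f_R0 x k / INR (S k).

Definition avg_iter (n : nat) (x : nat -> R) : nat -> R := Nat.iter n avg x.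

Lemma INR_S_pos (k : nat) : 0 < INR (S k).
Proof. apply lt_0_INR; lia. Qed.

Lemma avg_step (x : nat -> R) (k : nat) :
  INR (S (S k)) * avg x (S k) = INR (S k) * avg x k + x (S k).
Proof.
unfold avg; cbn [sum_f_R0]; field.
split; apply Rgt_not_eq, INR_S_pos.
Qed.

(** Makes [x - avg x] a discrete derivative of [avg x] in the variable [log k]; both energy
    inequalities rest on it. *)
Lemma avg_diff (x : nat -> R) (k : nat) :
  INR (S k) * (avg x (S k) - avg x k) = x (S k) - avg x (S k).
Proof. pose proof (avg_step x k) as H; rewrite (S_INR (S k)) in H; lra. Qed.

Lemma avg_0 (x : nat -> R) : avg x 0 = x 0%nat.
Proof. unfold avg; simpl; field. Qed.

Lemma avg_iter_0 (n : nat) (x : nat -> R) : avg_iter n x 0 = x 0%nat.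
Proof. induction n; [reflexivity|]; simpl; rewrite avg_0; exact IHn. Qed.

Lemma avg_le (x y : nat -> R) (K : nat) :
  (forall j, (j <= K)%nat -> x j <= y j) -> avg x K <= avg y K.
Proof.
intros H; unfold avg; apply Rmult_le_compat_r.
- apply Rlt_le, Rinv_0_lt_compat, INR_S_pos.
- apply sum_Rle; exact H.
Qed.

(** The operator is lower triangular with nonnegative entries, so a comparison up to index [K] is
    enough; part (b) needs this locality. *)
Lemma avg_iter_le (n : nat) (x y : nat -> R) (K : nat) :
  (forall j, (j <= K)%nat -> x j <= y j) -> avg_iter n x K <= avg_iter n y K.
Proof.
intros H; assert (G : forall j, (j <= K)%nat -> avg_iter n x j <= avg_iter n y j).
{ induction n as [|n IH]; [exact H|].
  intros j Hj; apply avg_le; intros i Hi; apply IH; lia. }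
apply G; lia.
Qed.

Lemma avg_iter_ext (n : nat) (x y : nat -> R) (K : nat) :
  (forall j, x j = y j) -> avg_iter n x K = avg_iter n y K.
Proof.
intros H; apply Rle_antisym; apply avg_iter_le; intros j _; rewrite H; lra.
Qed.

Lemma avg_lin (a b : R) (x y : nat -> R) (k : nat) :
  avg (fun j => a * x j + b * y j) k = a * avg x k + b * avg y k.
Proof.
assert (E : sum_f_R0 (fun j => a * x j + b * y j) k = a * sum_f_R0 x k + b * sum_f_R0 y k)
  by (induction k as [|k IH]; cbn [sum_f_R0]; [|rewrite IH]; ring).
unfold avg; rewrite E; field; apply Rgt_not_eq, INR_S_pos.
Qed.

Lemma avg_iter_lin (n : nat) (a b : R) (x y : nat -> R) (k : nat) :
  avg_iter n (fun j => a * x j + b * y j) k = a * avg_iter n x k + b * avg_iter n y k.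
Proof.
revert k; induction n as [|n IH]; intros k; [reflexivity|].
simpl; rewrite <- avg_lin.
apply (avg_iter_ext 1); exact IH.
Qed.

Lemma avg_iter_const (n : nat) (a : R) (k : nat) : avg_iter n (fun _ => a) k = a.
Proof.
revert k; induction n as [|n IH]; intros k; [reflexivity|].
transitivity (avg (fun _ => a) k); [exact (avg_iter_ext 1 _ _ k IH)|].
unfold avg; rewrite sum_cte; field; apply Rgt_not_eq, INR_S_pos.
Qed.

Lemma avg_iter_bound (n : nat) (x : nat -> R) (M : R) (k : nat) :
  (forall j, Rabs (x j) <= M) -> Rabs (avg_iter n x k) <= M.
Proof.
intros H; apply Rabs_le; split.
- rewrite <- (avg_iter_const n (- M) k); apply avg_iter_le; intros j _.
  pose proof (proj1 (Rabs_le_between _ _) (H j)); lra.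
- rewrite <- (avg_iter_const n M k); apply avg_iter_le; intros j _.
  pose proof (proj1 (Rabs_le_between _ _) (H j)); lra.
Qed.

Lemma avg_iter_lim (n : nat) (x : nat -> R) (l : R) :
  is_lim_seq x l -> is_lim_seq (avg_iter n x) l.
Proof.
intros H; induction n as [|n IH]; [exact H|]; simpl.
apply is_lim_seq_Reals, Cesaro_1, is_lim_seq_Reals, is_lim_seq_incr_1 in IH.
exact IH.
Qed.

(** * Energy estimates and uniform decay of the iterates *)

Definition energy (N : nat) (y : nat -> R) : R :=
  sum_f_R0 (fun i => y (S i) ^ 2 / INR (S i)) N.

Lemma energy_ge_0 (N : nat) (y : nat -> R) : 0 <= energy N y.
Proof.
apply cond_pos_sum; intros i; apply Rmult_le_pos; [apply pow2_ge_0|].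
apply Rlt_le, Rinv_0_lt_compat, INR_S_pos.
Qed.

Lemma energy_ext (N : nat) (x y : nat -> R) :
  (forall k, x k = y k) -> energy N x = energy N y.
Proof. intros H; apply sum_eq; intros i _; rewrite H; reflexivity. Qed.

(* With [f = avg y] and [d = y - f] one has [d k = k (f k - f (k - 1))], so
   [(y k ^ 2 - f k ^ 2 - d k ^ 2) / k = 2 f k (f k - f (k - 1))
     >= f k ^ 2 - f (k - 1) ^ 2], which telescopes. *)
Lemma energy_avg (N : nat) (y : nat -> R) :
  y 0%nat = 0 ->
  energy N (avg y) + energy N (fun k => y k - avg y k) <= energy N y.
Proof.
intros H0.
enough (G : energy N (avg y) + energy N (fun k => y k - avg y k)
            + avg y (S N) ^ 2 <= energy N y)
  by (pose proof (pow2_ge_0 (avg y (S N))); lra).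
assert (Step : forall k, avg y (S k) ^ 2 / INR (S k)
   + (y (S k) - avg y (S k)) ^ 2 / INR (S k) + avg y (S k) ^ 2 - avg y k ^ 2
   <= y (S k) ^ 2 / INR (S k)).
{ intros k; pose proof (INR_S_pos k) as Hk.
  set (f := avg y (S k)); set (f' := avg y k).
  assert (Hy : y (S k) = f + INR (S k) * (f - f'))
    by (pose proof (avg_diff y k); unfold f, f'; lra).
  rewrite Hy.
  replace ((f + INR (S k) * (f - f')) ^ 2 / INR (S k)) with
    (f ^ 2 / INR (S k) + (f + INR (S k) * (f - f') - f) ^ 2 / INR (S k)
     + 2 * f * (f - f')) by (field; lra).
  pose proof (pow2_ge_0 (f - f')); lra. }
unfold energy; induction N as [|N IH]; cbn [sum_f_R0].
- specialize (Step 0%nat); rewrite avg_0, H0 in Step; lra.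
- specialize (Step (S N)); lra.
Qed.

Lemma avg_sub_avg (y : nat -> R) (k : nat) :
  avg (fun j => y j - avg y j) k = avg y k - avg (avg y) k.
Proof.
transitivity (avg (fun j => 1 * y j + (-1) * avg y j) k).
- apply (avg_iter_ext 1); intros; ring.
- rewrite avg_lin; ring.
Qed.

(* The energies of the successive increments [T^m y - T^(m+1) y] decrease and
   add up to at most the energy of [y]. *)
Lemma energy_increment (n N : nat) (y : nat -> R) :
  y 0%nat = 0 ->
  energy N (avg_iter n y)
  + INR n * energy N (fun k => avg_iter n y k - avg_iter (S n) y k) <= energy N y.
Proof.
intros H0; induction n as [|n IH].
- simpl; lra.
- eapply Rle_trans; [|exact IH].
  set (f := avg_iter n y).
  assert (Hf0 : f 0%nat = 0) by (unfold f; rewrite avg_iter_0; exact H0).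
  change (avg_iter (S n) y) with (avg f).
  change (avg_iter (S (S n)) y) with (avg (avg f)).
  pose proof (energy_avg N f Hf0) as A1.
  assert (Hd0 : f 0%nat - avg f 0 = 0) by (rewrite avg_0; ring).
  pose proof (energy_avg N (fun k => f k - avg f k) Hd0) as A2.
  rewrite (energy_ext N (avg (fun k => f k - avg f k))
            (fun k => avg f k - avg (avg f) k)) in A2 by apply avg_sub_avg.
  pose proof (energy_ge_0 N (fun k => f k - avg f k - avg (fun j => f j - avg f j) k)) as A3.
  rewrite S_INR; pose proof (pos_INR n).
  cbv beta in A2, A3 |- *.
  nra.
Qed.

(** With [f = avg y] and [d = y - f], the step of [f ^ 2] at [k] is at most [2 f d / k], hence at
    most [(t f ^ 2 + d ^ 2 / t) / k]; summing telescopes from [f 0 = 0]. *)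
Lemma avg_sq_le_energy (N : nat) (y : nat -> R) (t : R) :
  0 < t -> y 0%nat = 0 ->
  avg y (S N) ^ 2 <= t * energy N (avg y) + / t * energy N (fun k => y k - avg y k).
Proof.
intros Ht H0.
assert (Step : forall k, avg y (S k) ^ 2 - avg y k ^ 2 <=
   t * (avg y (S k) ^ 2 / INR (S k)) + / t * ((y (S k) - avg y (S k)) ^ 2 / INR (S k))).
{ intros k; pose proof (INR_S_pos k) as Hk; pose proof (avg_diff y k) as Hd.
  set (f := avg y (S k)) in *; set (f' := avg y k) in *; set (d := y (S k) - f) in *.
  assert (Hf' : f' = f - d / INR (S k)) by (rewrite <- Hd; field; lra).
  rewrite Hf'.
  assert (0 <= (t * f - d) ^ 2 / (t * INR (S k)) + (d / INR (S k)) ^ 2).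
  { apply Rplus_le_le_0_compat; [|apply pow2_ge_0].
    apply Rmult_le_pos; [apply pow2_ge_0|].
    apply Rlt_le, Rinv_0_lt_compat; nra. }
  replace ((t * f - d) ^ 2 / (t * INR (S k)) + (d / INR (S k)) ^ 2) with
    (t * (f ^ 2 / INR (S k)) + / t * (d ^ 2 / INR (S k))
     - (f ^ 2 - (f - d / INR (S k)) ^ 2)) in H by (field; lra).
  lra. }
unfold energy; induction N as [|N IH]; cbn [sum_f_R0].
- specialize (Step 0%nat); rewrite avg_0, H0 in Step; lra.
- specialize (Step (S N)); lra.
Qed.

Lemma avg_iter_vanish_energy (y : nat -> R) (E : R) :
  y 0%nat = 0 -> (forall N, energy N y <= E) ->
  forall eps, 0 < eps ->
  exists n0, forall n k, (n0 <= n)%nat -> Rabs (avg_iter n y k) <= eps.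
Proof.
intros H0 HE eps Heps.
assert (HE0 : 0 <= E) by (apply Rle_trans with (2 := HE 0%nat), energy_ge_0).
(* This [t] keeps the first term of [avg_sq_le_energy] below [eps ^ 2 / 2] for all [n]; [E + 1]
   avoids a zero divisor. The second term is then small once [n] is large, as increments have energy
   at most [E / n]. *)
set (t := eps ^ 2 / (2 * (E + 1))).
assert (Hep : 0 < eps ^ 2) by (apply pow_lt; exact Heps).
assert (Ht : 0 < t) by (apply Rdiv_lt_0_compat; lra).
destruct (INR_unbounded (E / (t * (eps ^ 2 / 2)))) as [m Hm].
exists (S m); intros n k Hn.
destruct n as [|n]; [lia|].
assert (Hmn : INR m <= INR n) by (apply le_INR; lia).
destruct k as [|k]; [rewrite avg_iter_0, H0, Rabs_R0; lra|].
simpl; set (f := avg_iter n y).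
assert (Hf0 : f 0%nat = 0) by (unfold f; rewrite avg_iter_0; exact H0).
pose proof (avg_sq_le_energy k f t Ht Hf0) as A1.
pose proof (energy_increment (S n) k y H0) as A2.
pose proof (energy_increment n k y H0) as A3.
change (avg_iter (S n) y) with (avg f) in A2, A3; fold f in A3.
set (D := energy k (fun k0 => f k0 - avg f k0)) in *.
pose proof (energy_ge_0 k f); pose proof (HE k).
pose proof (energy_ge_0 k (fun k0 => avg f k0 - avg_iter (S (S n)) y k0)).
assert (HEf : energy k (avg f) <= E) by (pose proof (pos_INR (S n)); nra).
assert (HD0 : 0 <= D) by apply energy_ge_0.
assert (HnD : INR n * D <= E) by lra.
assert (B1 : t * energy k (avg f) <= eps ^ 2 / 2).
{ apply Rle_trans with (t * (E + 1)); [nra|]. unfold t; right; field; lra. }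
assert (B2 : / t * D <= eps ^ 2 / 2).
{ assert (Hte : 0 < t * (eps ^ 2 / 2)) by nra.
  apply Rmult_le_reg_l with t; [lra|].
  rewrite <- Rmult_assoc, Rinv_r, Rmult_1_l by lra.
  assert (HEm : E < INR n * (t * (eps ^ 2 / 2))).
  { apply Rmult_lt_reg_r with (/ (t * (eps ^ 2 / 2))).
    - apply Rinv_0_lt_compat; exact Hte.
    - rewrite Rmult_assoc, Rinv_r by lra. unfold Rdiv in *; lra. }
  pose proof (pos_INR n).
  nra. }
apply Rabs_le.
assert (avg f (S k) ^ 2 <= eps ^ 2) by lra.
split; nra.
Qed.

Lemma avg_iter_vanish (x : nat -> R) :
  x 0%nat = 0 -> is_lim_seq x 0 ->
  forall eps, 0 < eps ->
  exists n0, forall n k, (n0 <= n)%nat -> Rabs (avg_iter n x k) <= eps.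
Proof.
intros H0 Hx eps Heps.
apply is_lim_seq_spec in Hx.
assert (He2 : 0 < eps / 2) by lra.
destruct (Hx (mkposreal _ He2)) as [M HM]; simpl in HM.
(* The head [y] has finite energy, so its iterates vanish uniformly; the tail [z] stays below
   [eps / 2] because averaging does not increase a uniform bound. *)
set (y := fun k => if (k <=? M)%nat then x k else 0).
set (z := fun k => if (k <=? M)%nat then 0 else x k).
assert (Hy0 : y 0%nat = 0) by exact H0.
assert (Hz : forall k, Rabs (z k) <= eps / 2).
{ intros k; unfold z; destruct (Nat.leb_spec k M) as [h|h].
  - rewrite Rabs_R0; lra.
  - specialize (HM k ltac:(lia)); rewrite Rminus_0_r in HM; lra. }
assert (HE : forall N, energy N y <= energy M y).
{ assert (mono : forall N p, energy N y <= energy (N + p) y).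
  { intros N p; induction p as [|p IH]; [rewrite Nat.add_0_r; lra|].
    rewrite Nat.add_succ_r; unfold energy in *; cbn [sum_f_R0].
    eapply Rle_trans; [exact IH|].
    assert (0 <= y (S (S (N + p))) ^ 2 / INR (S (S (N + p)))); [|lra].
    apply Rmult_le_pos; [apply pow2_ge_0|].
    apply Rlt_le, Rinv_0_lt_compat, INR_S_pos. }
  assert (supp : forall p, energy (M + p) y = energy M y).
  { induction p as [|p IH]; [rewrite Nat.add_0_r; reflexivity|].
    rewrite Nat.add_succ_r; unfold energy in *; cbn [sum_f_R0].
    rewrite IH; unfold y at 2.
    destruct (Nat.leb_spec (S (S (M + p))) M); [lia|]. unfold Rdiv; ring. }
  intros N; eapply Rle_trans; [apply (mono N M)|].
  rewrite Nat.add_comm, supp; lra. }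
destruct (avg_iter_vanish_energy y _ Hy0 HE _ He2) as [n0 Hn0].
exists n0; intros n k Hn.
rewrite (avg_iter_ext n x (fun j => 1 * y j + 1 * z j)).
- rewrite avg_iter_lin, !Rmult_1_l.
  eapply Rle_trans; [apply Rabs_triang|].
  pose proof (Hn0 n k Hn); pose proof (avg_iter_bound n z (eps / 2) k Hz); lra.
- intros j; unfold y, z; destruct (j <=? M)%nat; ring.
Qed.

(** * Harmonic numbers and a lower bound of order [1 / sqrt n] *)

Fixpoint harm (i : nat) : R :=
  match i with O => 0 | S j => harm j + / INR (S j) end.

Lemma harm_ge_ln (i : nat) : ln (INR (S i)) <= harm i.
Proof.
induction i as [|i IH]; [simpl; rewrite ln_1; lra|].
cbn [harm]; pose proof (INR_S_pos i) as Hi.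
replace (INR (S (S i))) with (INR (S i) * (1 + / INR (S i)))
  by (rewrite (S_INR (S i)); field; lra).
pose proof (Rinv_0_lt_compat _ Hi) as Hi'.
rewrite ln_mult by lra.
assert (ln (1 + / INR (S i)) <= / INR (S i)); [|lra].
rewrite <- (ln_exp (/ INR (S i))) at 2.
apply ln_le; [lra|]. apply exp_ineq1_le.
Qed.

Lemma harm_unbounded (M : R) : exists i, M <= harm i.
Proof.
destruct (INR_unbounded (exp M)) as [i Hi].
exists i; apply Rle_trans with (2 := harm_ge_ln i).
rewrite <- (ln_exp M); apply ln_le; [apply exp_pos|]. rewrite S_INR; lra.
Qed.

Lemma harm_mono (i j : nat) : (i <= j)%nat -> harm i <= harm j.
Proof.
induction 1 as [|j _ IH]; [lra|]; cbn [harm].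
pose proof (Rinv_0_lt_compat _ (INR_S_pos j)); lra.
Qed.

(* [harm] increases by exactly the weight [1 / (i + 1)], so an interval of
   values of [harm] of length [B - A] carries weight at most [B - A + 1]. *)
Lemma sum_harm_window (u : nat -> R) (c A B : R) (N : nat) :
  A <= B -> (forall i, 0 <= u i <= c) ->
  (forall i, harm i < A \/ B < harm i -> u i = 0) ->
  sum_f_R0 (fun i => u i / INR (S i)) N <= c * (B - A + 1).
Proof.
intros HAB Hu Hsupp.
assert (Hc : 0 <= c) by (specialize (Hu 0%nat); lra).
(* The clipped harmonic number serves as a potential: it grows by the full weight while [harm i]
   lies in [[A, B]]. The cap is [B + 1] since the last such step may pass [B] by at most 1. *)
enough (G : sum_f_R0 (fun i => u i / INR (S i)) N <=
  c * Rmax 0 (Rmin (harm (S N)) (B + 1) - A)).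
{ eapply Rle_trans; [exact G|]; apply Rmult_le_compat_l; [exact Hc|].
  apply Rmax_lub; [lra|]. pose proof (Rmin_r (harm (S N)) (B + 1)); lra. }
assert (Step : forall i, u i / INR (S i) + c * Rmax 0 (Rmin (harm i) (B + 1) - A)
   <= c * Rmax 0 (Rmin (harm (S i)) (B + 1) - A)).
{ intros i; pose proof (Rinv_0_lt_compat _ (INR_S_pos i)) as Hi.
  assert (Hi1 : / INR (S i) <= 1).
  { rewrite <- Rinv_1; apply Rinv_le_contravar; [lra|].
    rewrite S_INR; pose proof (pos_INR i); lra. }
  cbn [harm]; set (w := / INR (S i)) in *; unfold Rdiv; fold w.
  destruct (Rlt_dec (harm i) A) as [h|h]; [|destruct (Rlt_dec B (harm i)) as [h'|h']].
  1,2: rewrite (Hsupp i) by tauto; rewrite Rmult_0_l, Rplus_0_l;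
    apply Rmult_le_compat_l; [exact Hc|];
    apply Rle_max_compat_l, Rplus_le_compat_r, Rle_min_compat_r; lra.
  rewrite !Rmin_left, !Rmax_right by lra.
  specialize (Hu i); nra. }
induction N as [|N IH]; cbn [sum_f_R0].
- specialize (Step 0%nat); cbn [harm] in Step |- *.
  assert (0 <= c * Rmax 0 (Rmin 0 (B + 1) - A))
    by (apply Rmult_le_pos; [exact Hc | apply Rmax_l]).
  lra.
- specialize (Step (S N)); lra.
Qed.

(* The positive part of [bump L m], divided by [k = i + 1], is a compactly
   supported test function replacing second-moment estimates: its pairing with
   [T^m x], [x >= 0], does not decrease in [m] (see [bump_diff]). *)
Definition bump (L : R) (m i : nat) : R := L + 2 * INR m - (harm i - INR m) ^ 2.

(** With [j = i + 1] the two sides differ by [(1 - 1/j) / (j (j + 1))]. The coefficient 2 of [INR m]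
    in [bump] is the least that keeps the gap nonnegative at [j = 1]. *)
Lemma bump_diff (L : R) (m i : nat) :
  bump L m i / INR (S i) - bump L m (S i) / INR (S (S i))
  <= bump L (S m) i / INR (S i) / INR (S (S i)).
Proof.
pose proof (INR_S_pos i) as Hi.
assert (Hi1 : 1 <= INR (S i)) by (rewrite S_INR; pose proof (pos_INR i); lra).
unfold bump; cbn [harm]; rewrite (S_INR (S i)), (S_INR m).
set (j := INR (S i)) in *; set (d := harm i - INR m).
replace (harm i + / j - INR m) with (d + / j) by (unfold d; ring).
replace (harm i - (INR m + 1)) with (d - 1) by (unfold d; ring).
assert (0 <= (1 - / j) / (j * (j + 1))).
{ apply Rmult_le_pos.
  - assert (/ j <= 1); [|lra]. rewrite <- Rinv_1; apply Rinv_le_contravar; lra.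
  - apply Rlt_le, Rinv_0_lt_compat; nra. }
replace ((1 - / j) / (j * (j + 1))) with
  ((L + 2 * (INR m + 1) - (d - 1) ^ 2) / j / (j + 1)
   - ((L + 2 * INR m - d ^ 2) / j - (L + 2 * INR m - (d + / j) ^ 2) / (j + 1)))
  in H by (field; lra).
lra.
Qed.

Definition pairing (L : R) (m N : nat) (x : nat -> R) : R :=
  sum_f_R0 (fun i => Rmax 0 (bump L m i) / INR (S i) * x (S i)) N.

(** The sign condition at [S N] removes the upper boundary term of the summation by parts, and
    [x 0 = 0] the lower one. *)
Lemma pairing_avg (L : R) (m N : nat) (x : nat -> R) :
  (forall k, 0 <= x k) -> x 0%nat = 0 -> bump L m (S N) <= 0 ->
  pairing L m N x <= pairing L (S m) N (avg x).
Proof.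
intros Hx H0 HN.
assert (Hf : forall k, 0 <= avg x k).
{ intros k; rewrite <- (avg_iter_const 1 0 k); apply (avg_iter_le 1); auto. }
enough (G : pairing L m N x <= pairing L (S m) N (avg x)
   + Rmax 0 (bump L m (S N)) * avg x (S N))
  by (rewrite Rmax_left in G by exact HN; lra).
(* Abel summation, using [sum_(j <= k) x j = (k + 1) avg x k]. *)
assert (Step : forall i,
  Rmax 0 (bump L m i) / INR (S i) * x (S i) + Rmax 0 (bump L m i) * avg x i
  <= Rmax 0 (bump L (S m) i) / INR (S i) * avg x (S i)
     + Rmax 0 (bump L m (S i)) * avg x (S i)).
{ intros i; pose proof (avg_step x i) as E; pose proof (Hf (S i)) as Hfi.
  pose proof (INR_S_pos i) as Hi; pose proof (INR_S_pos (S i)) as Hi'.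
  pose proof (bump_diff L m i) as Hd.
  set (P := bump L m i) in *; set (P' := bump L m (S i)) in *;
  set (Q := bump L (S m) i) in *.
  replace (Rmax 0 P / INR (S i) * x (S i) + Rmax 0 P * avg x i)
    with (Rmax 0 P / INR (S i) * (INR (S (S i)) * avg x (S i)))
    by (rewrite E; field; lra).
  rewrite <- Rmult_assoc, <- Rmult_plus_distr_r.
  apply Rmult_le_compat_r; [exact Hfi|].
  assert (HQ : 0 <= Rmax 0 Q / INR (S i)).
  { apply Rmult_le_pos; [apply Rmax_l|]. apply Rlt_le, Rinv_0_lt_compat, Hi. }
  pose proof (Rmax_l 0 P').
  (* Where [P <= 0] the left side is zero. Elsewhere [bump_diff] times [i + 2] applies, and positive
     parts only enlarge the right side. *)
  destruct (Rle_dec P 0) as [h|h].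
  - rewrite (Rmax_left 0 P) by exact h. unfold Rdiv at 1. rewrite !Rmult_0_l; lra.
  - rewrite (Rmax_right 0 P) by lra.
    apply Rle_trans with (Q / INR (S i) + P').
    + apply Rmult_le_compat_r with (r := INR (S (S i))) in Hd; [|lra].
      replace ((P / INR (S i) - P' / INR (S (S i))) * INR (S (S i)))
        with (P / INR (S i) * INR (S (S i)) - P') in Hd by (field; lra).
      replace (Q / INR (S i) / INR (S (S i)) * INR (S (S i)))
        with (Q / INR (S i)) in Hd by (field; lra).
      lra.
    + apply Rplus_le_compat; [|apply Rmax_r].
      apply Rmult_le_compat_r; [apply Rlt_le, Rinv_0_lt_compat, Hi | apply Rmax_r]. }
clear HN; unfold pairing; induction N as [|N IH]; cbn [sum_f_R0].
- specialize (Step 0%nat); rewrite avg_0, H0 in Step; lra.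
- specialize (Step (S N)).
  lra.
Qed.

Lemma pairing_avg_iter (L : R) (n N : nat) (x : nat -> R) :
  (forall k, 0 <= x k) -> x 0%nat = 0 ->
  (forall m, (m <= n)%nat -> bump L m (S N) <= 0) ->
  pairing L 0 N x <= pairing L n N (avg_iter n x).
Proof.
intros Hx H0 HN; induction n as [|n IH]; [apply Rle_refl|].
eapply Rle_trans; [apply IH; intros; apply HN; lia|].
apply pairing_avg; [|rewrite avg_iter_0; exact H0|apply HN; lia].
intros k; rewrite <- (avg_iter_const n 0 k); apply avg_iter_le; auto.
Qed.

Definition unit1 (k : nat) : R := if (k =? 1)%nat then 1 else 0.

Lemma unit1_nonneg (k : nat) : 0 <= unit1 k.
Proof. unfold unit1; destruct (k =? 1)%nat; lra. Qed.

(** The pairing starts at [L = 2n] or more and does not decrease. After [n] steps the bump has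
    height at most [4n] and half-width [2 sqrt n] in [harm], so its total weight is at most
    [20 n sqrt n]; dividing gives the bound. *)
Lemma avg_iter_unit1_ge (n : nat) (S0 : R) :
  (1 <= n)%nat -> (forall k, avg_iter n unit1 k <= S0) -> / (10 * sqrt (INR n)) <= S0.
Proof.
intros Hn HS.
assert (Hn1 : 1 <= INR n) by (apply (le_INR 1); exact Hn).
set (q := sqrt (INR n)).
assert (Hq2 : q * q = INR n) by (apply sqrt_sqrt; lra).
assert (Hq1 : 1 <= q) by (rewrite <- sqrt_1; apply sqrt_le_1; lra).
assert (Hpos : forall k, 0 <= avg_iter n unit1 k).
{ intros k; rewrite <- (avg_iter_const n 0 k); apply avg_iter_le; intros; apply unit1_nonneg. }
set (L := 2 * INR n).
(* Beyond harmonic number [n + 2q] every [bump L m] with [m <= n] is nonpositive, since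
   [2n + 2m <= 4n = (2q) ^ 2]. *)
destruct (harm_unbounded (INR n + 2 * q)) as [N HN].
assert (Hfar : forall m, (m <= n)%nat -> bump L m (S N) <= 0).
{ intros m Hm; apply le_INR in Hm; unfold bump, L.
  pose proof (harm_mono N (S N) ltac:(lia)).
  assert (2 * q <= harm (S N) - INR m) by lra.
  nra. }
pose proof (pairing_avg_iter L n N unit1 unit1_nonneg eq_refl Hfar) as HP.
(* Only [i = 0] contributes, and [bump L 0 0 = L]. *)
assert (Hlow : L <= pairing L 0 N unit1).
{ unfold pairing; clear - Hn1; induction N as [|N IH]; cbn [sum_f_R0].
  - unfold bump, unit1; simpl. rewrite Rmax_right by (unfold L; nra).
    right; field.
  - unfold unit1 at 2; simpl (_ =? 1)%nat; lra. }
assert (Hup : pairing L n N (avg_iter n unit1) <=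
  sum_f_R0 (fun i => Rmax 0 (bump L n i) / INR (S i)) N * S0).
{ unfold pairing; rewrite Rmult_comm, scal_sum; apply sum_Rle; intros i _.
  apply Rmult_le_compat_l; [|apply HS].
  apply Rmult_le_pos; [apply Rmax_l|].
  apply Rlt_le, Rinv_0_lt_compat, INR_S_pos. }
assert (HW : sum_f_R0 (fun i => Rmax 0 (bump L n i) / INR (S i)) N
   <= (4 * INR n) * ((INR n + 2 * q) - (INR n - 2 * q) + 1)).
{ apply sum_harm_window; [lra| |].
  - intros i; split; [apply Rmax_l|]. apply Rmax_lub; [lra|].
    unfold bump, L; pose proof (pow2_ge_0 (harm i - INR n)); lra.
  - intros i Hi; apply Rmax_left; unfold bump, L.
    destruct Hi; nra. }
assert (HS0 : 0 <= S0) by (eapply Rle_trans; [apply (Hpos 0%nat)|apply HS]).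
assert (H1 : 2 * INR n <= (4 * INR n * (5 * q)) * S0).
{ fold L; eapply Rle_trans; [exact Hlow|]; eapply Rle_trans; [exact HP|].
  eapply Rle_trans; [exact Hup|]. apply Rmult_le_compat_r; [exact HS0|].
  eapply Rle_trans; [exact HW|]. apply Rmult_le_compat_l; lra. }
apply Rmult_le_reg_l with (10 * q); [lra|].
rewrite Rinv_r by lra.
apply Rmult_le_reg_l with (2 * INR n); lra.
Qed.

(** * Transfer from real averages to complex sequences and the supremum norm *)

(** The bound makes the supremum finite, so [real] does not return its default value 0. *)
Lemma Sup_seq_bounded (u : nat -> R) (M : R) :
  (forall n, 0 <= u n <= M) ->
  (forall n, u n <= real (Sup_seq (fun k => Finite (u k)))) /\
  real (Sup_seq (fun k => Finite (u k))) <= M.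
Proof.
intros H.
assert (H1 : Rbar_le (Sup_seq (fun k => Finite (u k))) (Finite M)).
{ destruct (Rbar_le_lt_dec (Sup_seq (fun k => Finite (u k))) M) as [h|h]; [exact h|].
  apply Sup_seq_minor_lt in h; destruct h as [n Hn]; simpl in Hn.
  specialize (H n); lra. }
assert (H0 : forall n, Rbar_le (Finite (u n)) (Sup_seq (fun k => Finite (u k)))).
{ intros n; apply (Sup_seq_minor_le (fun k => Finite (u k)) _ n), Rbar_le_refl. }
split; [intros n; specialize (H0 n)|specialize (H0 0%nat)];
  destruct (Sup_seq (fun k => Finite (u k))); simpl in *; easy.
Qed.

Lemma cesaro_RtoC (y : nat -> C) (x : nat -> R) (k : nat) :
  (forall j, y j = RtoC (x j)) -> cesaro y k = RtoC (avg x k).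
Proof.
intros H; rewrite cesaro_re_im; unfold avg, RtoC; f_equal.
- f_equal; apply sum_eq; intros i _; rewrite H; reflexivity.
- rewrite (sum_eq _ (fun _ => 0)) by (intros i _; rewrite H; reflexivity).
  rewrite sum_cte; unfold Rdiv; ring.
Qed.

Lemma cesaro_iter_RtoC (n : nat) (x : nat -> R) (k : nat) :
  cesaro_iter n (fun j => RtoC (x j)) k = RtoC (avg_iter n x k).
Proof.
revert k; induction n as [|n IH]; intros k; [reflexivity|].
apply cesaro_RtoC; exact IH.
Qed.

Lemma in_c_RtoC (x : nat -> R) (l : R) :
  is_lim_seq x l -> in_c (fun k => RtoC (x k)).
Proof.
intros Hx; exists (RtoC l); intros P [eps HP].
destruct (Hx (ball l eps)) as [N HN]; [exists eps; auto|].
exists N; intros n Hn; apply HP; split; [apply (HN n Hn)|apply ball_center].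
Qed.

Lemma Cmod_iter_minus_proj0 (x : nat -> R) (n k : nat) :
  x 0%nat = 0 ->
  Cmod (seq_minus (cesaro_iter n (fun j => RtoC (x j))) (proj0 (fun j => RtoC (x j))) k)
  = Rabs (avg_iter n x k).
Proof.
intros H0; unfold seq_minus, proj0; rewrite cesaro_iter_RtoC, H0.
rewrite <- Cmod_R; f_equal; ring.
Qed.

Lemma supnorm_bounds (x : nat -> R) (n : nat) (M : R) :
  x 0%nat = 0 -> (forall k, Rabs (avg_iter n x k) <= M) ->
  let s := supnorm (seq_minus (cesaro_iter n (fun j => RtoC (x j)))
                              (proj0 (fun j => RtoC (x j)))) in
  (forall k, Rabs (avg_iter n x k) <= s) /\ s <= M.
Proof.
intros H0 HM s.
destruct (Sup_seq_bounded (fun k => Cmod (seq_minus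
   (cesaro_iter n (fun j => RtoC (x j))) (proj0 (fun j => RtoC (x j))) k)) M) as [A B].
- intros k; split; [apply Cmod_ge_0|]. rewrite Cmod_iter_minus_proj0; auto.
- split; [|exact B]. intros k; rewrite <- Cmod_iter_minus_proj0 by exact H0; apply A.
Qed.

Lemma in_X_RtoC (x : nat -> R) :
  x 0%nat = 0 -> is_lim_seq x 0 -> in_X (fun k => RtoC (x k)).
Proof.
intros H0 Hx; split; [exact (in_c_RtoC x 0 Hx)|].
exists (proj0 (fun j => RtoC (x j))); split; [apply in_c_proj0|].
apply is_lim_seq_spec; intros eps.
assert (He : 0 < eps / 2) by (destruct eps; simpl; lra).
destruct (avg_iter_vanish x H0 Hx _ He) as [n0 Hn0].
exists n0; intros n Hn.
destruct (supnorm_bounds x n (eps / 2) H0 (fun k => Hn0 n k Hn)) as [A B].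
pose proof (Rle_trans _ _ _ (Rabs_pos _) (A 0%nat)).
rewrite Rminus_0_r, Rabs_pos_eq by assumption; lra.
Qed.

Lemma supnorm_iter_ge (x : nat -> R) (M : R) (n k : nat) :
  x 0%nat = 0 -> (forall j, Rabs (x j) <= M) ->
  avg_iter n x k <= supnorm (seq_minus (cesaro_iter n (fun j => RtoC (x j)))
                              (proj0 (fun j => RtoC (x j)))).
Proof.
intros H0 HM.
destruct (supnorm_bounds x n M H0 (fun j => avg_iter_bound n x M j HM)) as [A _].
eapply Rle_trans; [apply Rle_abs|apply A].
Qed.

(** * Part (a): the unit vector at index 1, one witness for every rate [r] *)

Lemma unit1_lim : is_lim_seq unit1 0.
Proof.
apply is_lim_seq_ext_loc with (fun _ => 0); [|apply is_lim_seq_const].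
exists 2%nat; intros [|[|n]] Hn; try lia; reflexivity.
Qed.

Lemma unit1_series :
  ex_series (V := C_NormedModule)
    (fun k : nat => (RtoC (unit1 (S k)) - RtoC (unit1 0)) / RtoC (INR (S k)))%C.
Proof.
set (a := fun k : nat => ((RtoC (unit1 (S k)) - RtoC (unit1 0)) / RtoC (INR (S k)))%C).
exists (a 0%nat).
apply filterlim_ext with (fun _ : nat => a 0%nat); [|apply filterlim_const].
intros n; induction n as [|n IH]; [rewrite sum_O; reflexivity|].
rewrite sum_Sn, <- IH.
assert (E : a (S n) = RtoC 0) by (unfold a, unit1; simpl; unfold Cdiv; ring).
rewrite E; symmetry; apply (plus_zero_r (a 0%nat : C_NormedModule)).
Qed.

Lemma faster_than_sqrt (r : nat -> R) :
  (forall n : nat, 0 < r n) ->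
  is_domin eventually (fun n : nat => Rpower (INR n) (- (1 / 2))) r ->
  LimSup_seq (fun n : nat => / r n *
    supnorm (seq_minus (cesaro_iter n (fun k => RtoC (unit1 k)))
                       (proj0 (fun k => RtoC (unit1 k))))) = p_infty.
Proof.
intros Hr Hdom; apply is_LimSup_seq_unique; intros M N.
(* [A] is positive and exceeds [M], which may be negative. Domination with constant [1 / (10 A)]
   cancels the factor 10 of [avg_iter_unit1_ge] and leaves a ratio of at least [A]. *)
set (A := Rabs M + 1).
assert (HA : 0 < A) by (unfold A; pose proof (Rabs_pos M); lra).
assert (He : 0 < / (10 * A)) by (apply Rinv_0_lt_compat; lra).
destruct (Hdom (mkposreal _ He)) as [N0 HN0]; cbn [pos] in HN0.
(* The [+ 1] keeps [n] away from 0, where [Rpower] and the inverse of the square root only have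
   default values. *)
set (n := (N + N0 + 1)%nat); exists n; split; [unfold n; lia|].
specialize (HN0 n ltac:(unfold n; lia)).
set (s := supnorm _).
assert (Hn : (1 <= n)%nat) by (unfold n; lia).
assert (Hn0 : 0 < INR n) by (apply lt_0_INR; lia).
assert (Hs : / (10 * sqrt (INR n)) <= s).
{ apply avg_iter_unit1_ge; [exact Hn|]. intros k.
  apply (supnorm_iter_ge unit1 1 n k eq_refl).
  intros j; rewrite Rabs_pos_eq by apply unit1_nonneg.
  unfold unit1; destruct (j =? 1)%nat; lra. }
assert (Hq : 0 < sqrt (INR n)) by (apply sqrt_lt_R0; exact Hn0).
assert (E : Rpower (INR n) (- (1 / 2)) = / sqrt (INR n)).
{ rewrite Rpower_Ropp; f_equal.
  replace (1 / 2) with (/ 2) by field; apply Rpower_sqrt; exact Hn0. }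
assert (HrA : r n <= / (10 * A) * / sqrt (INR n)).
{ rewrite E in HN0; unfold norm in HN0; simpl in HN0; unfold abs in HN0; simpl in HN0.
  rewrite !Rabs_pos_eq in HN0; [exact HN0| |].
  - apply Rlt_le, Rinv_0_lt_compat, Hq.
  - apply Rlt_le, Hr. }
apply Rlt_le_trans with A; [unfold A; pose proof (Rle_abs M); lra|].
specialize (Hr n).
apply Rmult_le_reg_l with (r n); [exact Hr|].
rewrite <- Rmult_assoc, Rinv_r, Rmult_1_l by lra.
apply Rle_trans with (2 := Hs).
replace (/ (10 * sqrt (INR n))) with (/ (10 * A) * / sqrt (INR n) * A) by (field; lra).
apply Rmult_le_compat_r; lra.
Qed.

(** * Part (b): decay slower than a prescribed rate *)

Definition tail1 (k : nat) : R := match k with O => 0 | S _ => 1 end.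

Lemma avg_iter_tail1_ge (n : nat) : exists k, 1 / 2 <= avg_iter n tail1 k.
Proof.
assert (H : is_lim_seq (avg_iter n tail1) 1).
{ apply avg_iter_lim, is_lim_seq_incr_1; apply is_lim_seq_const. }
apply is_lim_seq_spec in H.
destruct (H (mkposreal (1/2) ltac:(lra))) as [N HN]; simpl in HN.
exists N; specialize (HN N (le_n _)); apply Rabs_lt_between in HN; lra.
Qed.

(** Indices with [K n < k] contribute 0 instead of being left out, so the supremum never runs over
    an empty family; as [r] is positive, this does not alter a nonempty one. *)
Definition slow_term (r : nat -> R) (K : nat -> nat) (k n : nat) : R :=
  if (k <=? K n)%nat then r n else 0.

Definition slow (r : nat -> R) (K : nat -> nat) (k : nat) : R :=
  match k with
  | O => 0
  | S _ => 2 * real (Sup_seq (fun n => Finite (slow_term r K k n)))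
  end.

(** [M] is left free: a bound on all of [r] shows that [slow] is bounded, a bound on late terms
    gives its limit. *)
Lemma slow_bounds (r : nat -> R) (K : nat -> nat) (k : nat) (M : R) :
  (forall n, 0 <= slow_term r K (S k) n <= M) ->
  (forall n, (S k <= K n)%nat -> 2 * r n <= slow r K (S k)) /\
  0 <= slow r K (S k) <= 2 * M.
Proof.
intros H; destruct (Sup_seq_bounded _ M H) as [A B]; unfold slow; split.
- intros n Hn; specialize (A n); unfold slow_term in A at 1.
  rewrite (proj2 (Nat.leb_le _ _) Hn) in A; lra.
- specialize (A 0%nat); specialize (H 0%nat); lra.
Qed.

Lemma slow_lim (r : nat -> R) (K : nat -> nat) :
  (forall n : nat, 0 < r n) -> is_lim_seq r 0 -> is_lim_seq (slow r K) 0.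
Proof.
intros Hr Hlim; apply is_lim_seq_spec; intros eps.
assert (He : 0 < eps / 4) by (destruct eps; simpl; lra).
apply is_lim_seq_spec in Hlim; destruct (Hlim (mkposreal _ He)) as [N HN]; simpl in HN.
(* For [k] beyond [B] only terms with [n >= N] survive, and these are below [eps / 4]. *)
assert (HB : exists B, forall n, (n < N)%nat -> (K n <= B)%nat).
{ clear; induction N as [|N [B HB]]; [exists 0%nat; lia|].
  exists (B + K N)%nat; intros n Hn.
  destruct (Nat.eq_dec n N) as [->|]; [lia|]. specialize (HB n ltac:(lia)); lia. }
destruct HB as [B HB]; exists (S B); intros [|k] Hk; [lia|].
destruct (slow_bounds r K k (eps / 4)) as [_ [A1 A2]].
- intros n; unfold slow_term; destruct (Nat.leb_spec (S k) (K n)); [|lra].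
  assert (Hn : (N <= n)%nat).
  { destruct (Nat.le_gt_cases N n); [assumption|]. specialize (HB n ltac:(lia)); lia. }
  specialize (HN n Hn); rewrite Rminus_0_r in HN.
  apply Rabs_lt_between in HN; specialize (Hr n); lra.
- rewrite Rminus_0_r, Rabs_pos_eq by exact A1; lra.
Qed.

Lemma arbitrarily_slow (r : nat -> R) :
  (forall n : nat, 0 < r n) -> is_lim_seq r 0 ->
  exists x : nat -> R, x 0%nat = 0 /\ is_lim_seq x 0 /\
    (exists M, forall k, Rabs (x k) <= M) /\
    forall n, exists k, r n <= avg_iter n x k.
Proof.
intros Hr Hlim.
set (K := fun n => proj1_sig (constructive_indefinite_description _ (avg_iter_tail1_ge n))).
assert (HK : forall n, 1 / 2 <= avg_iter n tail1 (K n))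
  by (intros n; exact (proj2_sig (constructive_indefinite_description _ (avg_iter_tail1_ge n)))).
assert (Hbd : exists M, forall n, r n <= M).
{ destruct (filterlim_bounded (K := R_AbsRing) (V := R_NormedModule) r) as [M HM];
    [exists 0; exact Hlim|].
  exists M; intros n; eapply Rle_trans; [apply Rle_abs|apply HM]. }
destruct Hbd as [M HM].
assert (HM0 : 0 < M) by (eapply Rlt_le_trans; [apply (Hr 0%nat)|apply HM]).
assert (Hst : forall k n, 0 <= slow_term r K (S k) n <= M).
{ intros k n; unfold slow_term; destruct (S k <=? K n)%nat; [|lra].
  split; [apply Rlt_le, Hr | apply HM]. }
exists (slow r K); split; [reflexivity|split; [apply slow_lim; assumption|split]].
- exists (2 * M); intros [|k]; [simpl; rewrite Rabs_R0; lra|].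
  destruct (slow_bounds r K k M (Hst k)) as [_ [A1 A2]].
  rewrite Rabs_pos_eq; assumption.
- intros n; exists (K n).
  (* Up to index [K n] the sequence dominates [2 r n] times [tail1]; the factor 2 offsets the
     [1 / 2] in [HK]. The zero summand only fits the shape of [avg_iter_lin]. *)
  apply Rle_trans with (avg_iter n (fun j => 2 * r n * tail1 j + 0 * tail1 j) (K n)).
  + rewrite avg_iter_lin; specialize (HK n); specialize (Hr n); nra.
  + apply avg_iter_le; intros [|j] Hj; [simpl; lra|].
    destruct (slow_bounds r K j M (Hst j)) as [A _].
    specialize (A n Hj); change (tail1 (S j)) with 1; lra.
Qed.

Theorem proposition3p10 :
  (forall r : nat -> R,
     (forall n : nat, 0 < r n) ->
     is_domin eventually (fun n : nat => Rpower (INR n) (- (1 / 2))) r ->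
     exists x : nat -> C,
       in_X x /\
       ex_series (V := C_NormedModule)
         (fun k : nat => (x (S k) - x 0%nat) / RtoC (INR (S k)))%C /\
       LimSup_seq
         (fun n : nat =>
            / r n * supnorm (seq_minus (cesaro_iter n x) (proj0 x))) = p_infty)
  /\
  (forall r : nat -> R,
     (forall n : nat, 0 < r n) ->
     is_lim_seq r 0 ->
     exists x : nat -> C,
       in_X x /\
       forall n : nat,
         supnorm (seq_minus (cesaro_iter n x) (proj0 x)) >= r n).
Proof.
split; intros r Hr Hlim.
- exists (fun k => RtoC (unit1 k)); split; [|split].
  + exact (in_X_RtoC unit1 eq_refl unit1_lim).
  + exact unit1_series.
  + exact (faster_than_sqrt r Hr Hlim).
- destruct (arbitrarily_slow r Hr Hlim) as (x & H0 & Hx & [M HM] & Hge).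
  exists (fun k => RtoC (x k)); split; [exact (in_X_RtoC x H0 Hx)|].
  intros n; destruct (Hge n) as [k Hk]; apply Rle_ge.
  eapply Rle_trans; [exact Hk|]. exact (supnorm_iter_ge x M n k H0 HM).
Qed.
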